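(* Let $n\ge 2$, $1\le r,s\le n-1$ and $p=\lfloor rs/n\rfloor$. Assume that $p=0$, or that $r+s-n\ge 0$ and $p=r+s-n$. Let $w=w_{s,r}$ and $P=P_{S\setminus\{\alpha_r\}}$. Then $$G(r,n)^{ss}_{\lambda}(\mathcal L(\varpi_r)) = H\cdot\bigl(U_w wP/P\setminus\{wP/P\}\bigr).$$
   Context: Work over $\mathbb C$. $G=SL(n,\mathbb C)$, $T$ = diagonal torus, $B\supset T$ = upper triangular Borel subgroup, $S=\{\alpha_1,\dots,\alpha_{n-1}\}$ the simple roots, $s_i=s_{\alpha_i}$ the simple reflections, $\varpi_i$ the fundamental weights. $P=P_{S\setminus\{\alpha_r\}}$ is the maximal parabolic subgroup containing $B$ that omits $\alpha_r$, so $G/P=G(r,n)$, the Grassmannian of $r$-dimensional subspaces of $\mathbb C^n$; $\mathcal L(\varpi_r)$ is the (Plücker) line bundle on it associated to $\varpi_r$, with its natural $G$-linearization. For $w$ a minimal coset representative in $W/W_P$, $U_w wP/P=BwP/P$ is the Schubert cell of $w$. $\lambda:\mathbb G_m\to T$ is $\lambda(t)=\operatorname{diag}(t^{n-s},\dots,t^{n-s},t^{-s},\dots,t^{-s})$ ($s$ entries $t^{n-s}$, then $n-s$ entries $t^{-s}$); $G(r,n)^{ss}_\lambda(\mathcal L(\varpi_r))$ is the set of points $x$ at which some $\lambda(\mathbb G_m)$-invariant section of some $\mathcal L(\varpi_r)^{\otimes d}$, $d\ge 1$, does not vanish. $H=SL(s,\mathbb C)\times SL(n-s,\mathbb C)$,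 embedded block-diagonally in $G$ (the semisimple part of the centralizer of $\lambda$). $w_{s,r}=(s_s\cdots s_{p+1})(s_{s+1}\cdots s_{p+2})\cdots(s_{s+r-p-1}\cdots s_r)$, where in each bracket the indices decrease by one. *)

(* Defs.v *)
From HB Require Import structures.
From mathcomp Require Import all_boot all_order all_fingroup all_algebra.
From mathcomp Require Import boolp classical_sets.
(* Not imported: the notations of mpoly clash with those of classical_sets. *)
From mathcomp Require mpoly.

Set Implicit Arguments.
Unset Strict Implicit.
Unset Printing Implicit Defensive.

Import GRing.Theory.
Local Open Scope ring_scope.
Local Open Scope classical_set_scope.

Definition SL (F : fieldType) (n : nat) : set 'M[F]_n := [set g | \det g = 1].

Definition borel (F : fieldType) (n : nat) : set 'M[F]_n :=
  [set b | SL b /\ forall i j : 'I_n, (j < i)%N -> b i j = 0].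
Arguments borel F n : clear implicits.

(* [p] cut into blocks of sizes [r] and [n - r]; meaningful when [r <= n], in
   which case [conform_mx] is just the cast along [n = r + (n - r)]. *)
Definition to_blocks (F : fieldType) (n r : nat) (p : 'M[F]_n) :
    'M[F]_(r + (n - r)) :=
  conform_mx 0 p.

Definition of_blocks (F : fieldType) (n r : nat) (p : 'M[F]_(r + (n - r))) :
    'M[F]_n :=
  conform_mx 0 p.

(* The maximal parabolic subgroup omitting the simple root [alpha_r]. *)
Definition parabolic (F : fieldType) (n r : nat) : set 'M[F]_n :=
  [set p | SL p /\ dlsubmx (to_blocks r p) = 0].
Arguments parabolic F n r : clear implicits.

(* The fundamental weight [varpi_r], as a character of [parabolic n r]: on the
   diagonal torus it is [t_1 ... t_r]. *)
Definition fund_weight (F : fieldType) (n r : nat) (p : 'M[F]_n) : F :=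
  \det (ulsubmx (to_blocks r p)).

(* SL_s x SL_(n-s), block-diagonally. *)
Definition levi_ss (F : fieldType) (n s : nat) : set 'M[F]_n :=
  [set h | exists (a : 'M[F]_s) (b : 'M[F]_(n - s)),
     [/\ SL a, SL b & h = of_blocks (block_mx a 0 0 b)]].
Arguments levi_ss F n s : clear implicits.

Definition lambda (F : fieldType) (n s : nat) (t : F) : 'M[F]_n :=
  diag_mx (\row_(i < n) if (i < s)%N then t ^+ (n - s) else t ^- s).

Definition grassmannian (F : fieldType) (r n : nat) :
    set {vspace 'cV[F]_n} :=
  [set V | \dim V = r].
Arguments grassmannian F r n : clear implicits.

Definition mxact (F : fieldType) (n : nat) (g : 'M[F]_n)
    (V : {vspace 'cV[F]_n}) : {vspace 'cV[F]_n} :=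
  (linfun (mulmx g : 'cV[F]_n -> 'cV[F]_n) @: V)%VS.

Definition translates (F : fieldType) (n : nat) (K : set 'M[F]_n)
    (X : set {vspace 'cV[F]_n}) : set {vspace 'cV[F]_n} :=
  [set V | exists2 k, K k & exists2 U, X U & V = mxact k U].

(* The base point of G/P = G(r, n), i.e. the span of the first [r] vectors of
   the standard basis; the coset [g P] is the point
   [mxact g (base_point F r n)]. *)
Definition base_point (F : fieldType) (r n : nat) : {vspace 'cV[F]_n} :=
  (\sum_(i < n | (i < r)%N) <[delta_mx i ord0]>)%VS.
Arguments base_point F r n : clear implicits.

Definition regular_on_SL (F : fieldType) (n : nat) (f : 'M[F]_n -> F) : Prop :=
  exists q : mpoly.mpoly (n * n) F, forall g : 'M[F]_n, SL g ->
    f g = mpoly.meval (fun k => mxvec g 0 k) q.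

(* Sections of the [d]-th power of the line bundle associated to [varpi_r], as
   equivariant regular functions on SL_n.  The sign of the character is the
   one making the bundle ample: for [d = 1] the sections include the
   [r x r] minors of the first [r] columns, i.e. the Pluecker coordinates. *)
Definition line_bundle_section (F : fieldType) (n r d : nat)
    (f : 'M[F]_n -> F) : Prop :=
  regular_on_SL f /\
  forall g p, SL g -> parabolic F n r p ->
    f (g *m p) = fund_weight r p ^+ d * f g.

(* G acts on sections by [(h . f) g = f (h^-1 g)]. *)
Definition lambda_invariant (F : fieldType) (n s : nat) (f : 'M[F]_n -> F) :
    Prop :=
  forall (t : F) (g : 'M[F]_n), t != 0 -> SL g -> f (lambda n s t *m g) = f g.

(* By equivariance, whether [f g] vanishes depends only on the coset [g P]. *)
Definition semistable (F : fieldType) (r n s : nat) :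
    set {vspace 'cV[F]_n} :=
  [set V | grassmannian F r n V /\
     exists (d : nat) (f : 'M[F]_n -> F),
       [/\ (1 <= d)%N, line_bundle_section r d f, lambda_invariant s f &
           exists g, [/\ SL g, V = mxact g (base_point F r n) & f g != 0]]].
Arguments semistable F r n s : clear implicits.

(* The simple reflection exchanging the [i]-th and [i+1]-st basis vectors,
   counted from 1 (so the ordinals [i - 1] and [i]), for [1 <= i <= n - 1]. *)
Definition simple_refl (n i : nat) : 'S_n :=
  match insub i.-1, insub i with
  | Some a, Some b => tperm a b
  | _, _ => 1%g
  end.

(* (s_s ... s_(p+1)) (s_(s+1) ... s_(p+2)) ... (s_(s+r-p-1) ... s_r) *)
Definition w_elt (n p s r : nat) : 'S_n :=
  (\prod_(j < r - p) \prod_(k < s - p) simple_refl n (s + j - k))%g.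

(* The point wP/P.  The product of 'S_n composes from left to right, but
   [perm_mx] is multiplicative and sends [simple_refl n i] to the matrix of that
   reflection acting on columns, so [perm_mx w] is the product of these
   matrices in the written order.  Its determinant is a sign; a representative
   of [w] in SL_n differs from it by a diagonal factor fixing [base_point]. *)
Definition torus_point (F : fieldType) (r n : nat) (w : 'S_n) :
    {vspace 'cV[F]_n} :=
  mxact (perm_mx w) (base_point F r n).
Arguments torus_point F r {n} w.

(* BwP/P *)
Definition schubert_cell (F : fieldType) (r n : nat) (w : 'S_n) :
    set {vspace 'cV[F]_n} :=
  translates (borel F n) [set torus_point F r w].
Arguments schubert_cell F r {n} w.

(* Main.v *)
(* Write C^n = E + F with E spanned by the first s basis vectors.  A point V of
   the Grassmannian is semistable iff
   dim (V :&: E) <= r s / n <= dim (projection of V to E).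
   Sufficiency: products of powers of two generalized Pluecker coordinates, one
   of nonpositive and one of nonnegative weight, are invariant sections.
   Necessity, without knowing all sections: V can be written h (1 + N) W_k,
   with h in H, N : F -> E and W_k = <e_1, ..., e_k, e_(s+1), ..., e_(s+r-k)>, and
   lambda(t) turns 1 + N into 1 + t^n N; hence an invariant section of degree d
   takes at V the value t^(d (k n - r s)) times a polynomial in t, which forces
   k n <= r s.
   The hypothesis on p leaves k = p as the only possibility, so V is the
   H-translate of (1 + N) W_p, a point of the Schubert cell of W_p = wP/P.
   Finally a point of the cell projects to E with rank > p unless it is W_p. *)
Require Import Defs.
From mathcomp Require Import all_boot all_order all_fingroup all_algebra.
From mathcomp Require Import boolp classical_sets reals complex.
(* The notations of mpoly are left out: they clash with those of classical_sets. *)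
From mathcomp Require Import -(notations) mpoly.
From mathcomp Require Import zify.

Set Implicit Arguments.
Unset Strict Implicit.
Unset Printing Implicit Defensive.

Import GRing.Theory Num.Theory.
Local Open Scope classical_set_scope.

(** * Subspaces as column spaces of matrices *)

Section ColumnSpace.
Local Open Scope ring_scope.

Variable F : fieldType.

Definition colspan n m (M : 'M[F]_(n, m)) : {vspace 'cV[F]_n} :=
  limg (linfun (mulmx M : 'cV[F]_m -> 'cV[F]_n)).

Lemma memv_colspan n m (M : 'M[F]_(n, m)) (v : 'cV[F]_n) :
  reflect (exists u, v = M *m u) (v \in colspan M).
Proof.
apply: (iffP memv_imgP) => [[u _ ->]|[u ->]]; exists u; rewrite ?lfunE //.
by rewrite memvf.
Qed.

Lemma colspan_subP n m k (M : 'M[F]_(n, m)) (N : 'M[F]_(n, k)) :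
  reflect (exists Q, N = M *m Q) (colspan N <= colspan M)%VS.
Proof.
apply: (iffP subvP) => [sNM|[Q ->] v /memv_colspan[u ->]]; last first.
  by apply/memv_colspan; exists (Q *m u); rewrite mulmxA.
suff /submxP[Q e] : (N^T <= M^T)%MS.
  by exists Q^T; apply: trmx_inj; rewrite trmx_mul trmxK.
apply/row_subP => i.
have /memv_colspan[u] : col i N \in colspan M.
  apply: sNM; apply/memv_colspan; exists (delta_mx i ord0).
  by rewrite colE.
by move=> e; rewrite -tr_col e trmx_mul submxMl.
Qed.

Lemma colspan_eq n m k (M : 'M[F]_(n, m)) (N : 'M[F]_(n, k)) Q Q' :
  N = M *m Q -> M = N *m Q' -> colspan M = colspan N.
Proof.
move=> e e'; apply/eqP; rewrite eqEsubv.
by apply/andP; split; apply/colspan_subP; [exists Q' | exists Q].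
Qed.

Lemma mxact_colspan n m (g : 'M[F]_n) (M : 'M[F]_(n, m)) :
  mxact g (colspan M) = colspan (g *m M).
Proof.
apply/vspaceP => v; apply/memv_imgP/memv_colspan => [[w]|[u ->]].
  by case/memv_colspan=> u -> ->; exists u; rewrite lfunE /= mulmxA.
exists (M *m u); last by rewrite lfunE /= mulmxA.
by apply/memv_colspan; exists u.
Qed.

Lemma dim_colspan n m (M : 'M[F]_(n, m)) : \dim (colspan M) = \rank M.
Proof.
have M_base := mulmx_base M.
have eM : colspan M = colspan (col_base M).
  apply: (@colspan_eq _ _ _ _ _ (pinvmx (row_base M)) (row_base M)).
    by rewrite -(mulmxKp (row_base_free M) (col_base M)) M_base.
  by rewrite M_base.
rewrite eM limg_dim_eq ?dimvf.
  by rewrite /dim /= muln1.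
apply/eqP; rewrite -subv0; apply/subvP => u; rewrite memv_cap memv_ker lfunE /=.
case/andP=> _ /eqP e; rewrite memv0; apply/eqP/trmx_inj; rewrite trmx0.
have /row_free_inj inj : row_free (col_base M)^T.
  by rewrite /row_free mxrank_tr; exact: col_base_full.
by apply: inj; rewrite mul0mx -trmx_mul e trmx0.
Qed.

Lemma base_pointE r n : base_point F r n = colspan (pid_mx r : 'M_(n, r)).
Proof.
apply/eqP; rewrite eqEsubv; apply/andP; split.
  apply/subv_sumP => i ri; rewrite -memvE; apply/memv_colspan.
  exists (delta_mx (Ordinal ri) ord0); rewrite -colE.
  by apply/colP => j; rewrite !mxE eqxx andbT -val_eqE /=; case: eqP => // ->; rewrite ri.
apply/subvP => v /memv_colspan[u ->]; rewrite [_ *m u]matrix_sum_delta.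
apply: memv_suml => i _; rewrite big_ord1; have [ri|ri] := ltnP i r.
  rewrite memvZ // (subvP (sumv_sup i _ (subvv _))) //; exact: memv_line.
rewrite mxE big1 ?scale0r ?mem0v // => j _.
by rewrite mxE ltnNge ri andbF mul0r.
Qed.

End ColumnSpace.

(** * Block matrices: parabolic, Levi subgroup, [lambda] and unipotent elements *)

Section Blocks.
Local Open Scope ring_scope.

Variable F : fieldType.

Lemma parabolic_pid n r (p : 'M[F]_n) (T : 'M[F]_r) : (r <= n)%N -> SL p ->
  p *m (pid_mx r : 'M_(n, r)) = pid_mx r *m T ->
  parabolic F n r p /\ fund_weight r p = \det T.
Proof.
move=> le_rn; rewrite /parabolic /fund_weight /to_blocks /SL /=.
have e : n = (r + (n - r))%N by rewrite subnKC.
(* Once the size is literally [r + q], the cast [conform_mx] is the identity. *)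
move: (n - r)%N e => q e; subst n; rewrite conform_mx_id => dp.
rewrite -[p]submxK pid_mx_col mul_block_col mul_col_mx !mulmx0 !mulmx1 !addr0.
rewrite mul1mx mul0mx => /eq_col_mx[e1 e2]; split; first split.
- by rewrite submxK.
- by rewrite block_mxKdl.
- by rewrite block_mxKul e1.
Qed.

Lemma fund_weight_pid n r (p : 'M[F]_n) : (r <= n)%N -> parabolic F n r p ->
  exists2 T : 'M_r, p *m (pid_mx r : 'M_(n, r)) = pid_mx r *m T &
    fund_weight r p = \det T.
Proof.
move=> le_rn [_]; rewrite /fund_weight /to_blocks /=.
have e : n = (r + (n - r))%N by rewrite subnKC.
move: (n - r)%N e => q e; subst n; rewrite conform_mx_id => dl0.
exists (ulsubmx p) => //; rewrite -{1}[p]submxK dl0 pid_mx_col mul_block_col mul_col_mx.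
by rewrite !mulmx0 !mulmx1 !addr0 mul1mx mul0mx.
Qed.

Lemma levi_ssP s m (h : 'M[F]_(s + m)) :
  levi_ss F (s + m) s h <->
  exists (a : 'M_s) (b : 'M_m),
    [/\ \det a = 1, \det b = 1 & h = block_mx a 0 0 b].
Proof.
rewrite /levi_ss /of_blocks /SL /=.
move: (s + m - s)%N (addKn s m) => m' e; subst m'.
by split=> -[a [b [da db ->]]]; exists a, b; rewrite conform_mx_id.
Qed.

Lemma lambdaE s m (t : F) :
  lambda (s + m) s t = block_mx (t ^+ m)%:M 0 0 (t ^- s)%:M.
Proof.
rewrite /lambda addKn -(diag_const_mx s) -(diag_const_mx m) -diag_mx_row.
congr diag_mx; apply/rowP => i; rewrite !mxE.
by case: splitP => j _; rewrite mxE.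
Qed.

Lemma det_lambda s m (t : F) : t != 0 -> \det (lambda (s + m) s t) = 1.
Proof.
move=> t0; rewrite lambdaE det_ublock !det_scalar -exprVn -!exprM mulnC.
by rewrite -exprMn divff // expr1n.
Qed.

Definition transvec s m (N : 'M[F]_(s, m)) : 'M_(s + m) :=
  block_mx 1%:M N 0 1%:M.

Lemma det_transvec s m (N : 'M[F]_(s, m)) : \det (transvec N) = 1.
Proof. by rewrite det_ublock !det1 mulr1. Qed.

Lemma transvec0 s m : transvec 0 = 1%:M :> 'M_(s + m).
Proof. by rewrite /transvec -scalar_mx_block. Qed.

(** Conjugation by [lambda] multiplies the upper right block by [t^m / t^(-s)]. *)
Lemma lambda_transvec s m (t : F) (N : 'M[F]_(s, m)) : t != 0 ->
  lambda (s + m) s t *m transvec N =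
  transvec (t ^+ (s + m) *: N) *m lambda (s + m) s t.
Proof.
move=> t0; rewrite lambdaE /transvec !mulmx_block.
rewrite !(mulmx0, mul0mx, mul1mx, mulmx1, addr0, add0r).
congr block_mx; rewrite mul_scalar_mx mul_mx_scalar scalerA.
by rewrite exprD mulrA [t ^- s * _]mulrC divff ?mul1r // expf_neq0.
Qed.

Lemma lambda_levi s m (t : F) (a : 'M_s) (b : 'M_m) :
  lambda (s + m) s t *m block_mx a 0 0 b =
  block_mx a 0 0 b *m lambda (s + m) s t.
Proof.
rewrite lambdaE !mulmx_block !(mulmx0, mul0mx, addr0, add0r).
by rewrite !mul_scalar_mx !mul_mx_scalar.
Qed.

(* Its columns are [e_1, ..., e_k, e_(s+1), ..., e_(s+l)]. *)
Definition stdmx s m k l : 'M[F]_(s + m, k + l) :=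
  block_mx (pid_mx k) 0 0 (pid_mx l).

Lemma stdmx_linv s m k l : (k <= s)%N -> (l <= m)%N ->
  (stdmx s m k l)^T *m stdmx s m k l = 1%:M.
Proof.
move=> ks lm; rewrite /stdmx tr_block_mx !trmx0 !tr_pid_mx mulmx_block.
rewrite !(mulmx0, mul0mx, addr0, add0r) !pid_mx_id // !pid_mx_1.
by rewrite -scalar_mx_block.
Qed.

Lemma mulmx_diag_stdmx s m k l (x y : F) :
  block_mx x%:M 0 0 y%:M *m stdmx s m k l =
  stdmx s m k l *m block_mx x%:M 0 0 y%:M.
Proof.
rewrite /stdmx !mulmx_block !(mulmx0, mul0mx, addr0, add0r).
by rewrite !mul_scalar_mx !mul_mx_scalar.
Qed.

End Blocks.

(** * Normal form of a subspace under the Levi and unipotent subgroups *)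

Section NormalForm.
Local Open Scope ring_scope.

(** Block elimination: [l] is the rank of the lower block and [k] that of the upper block on the
    kernel of the lower one, that is, the dimension of [V :&: E]. Rank factorizations give [b] and
    [a]; the rest of the upper block goes into [N]. *)
Lemma normal_form_GL (F : fieldType) s m r (M : 'M[F]_(s + m, r)) :
  \rank M = r ->
  exists k l (a : 'M_s) (b : 'M_m) (N : 'M_(s, m)),
    [/\ [/\ (k <= s)%N, (l <= m)%N & (k + l)%N = r],
        a \in unitmx, b \in unitmx &
        colspan M = colspan (block_mx a 0 0 b *m transvec N *m stdmx F s m k l)].
Proof.
move=> rM.
pose M1 := usubmx M; pose M2 := dsubmx M.
pose b := col_ebase M2; pose R := row_ebase M2; pose l := \rank M2.
have uR : R \in unitmx by exact: row_ebase_unit.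
have ub : b \in unitmx by exact: col_ebase_unit.
have lm : (l <= m)%N by exact: rank_leq_row.
have lr : (l <= r)%N by exact: rank_leq_col.
have eM2 : M2 = b *m pid_mx l *m R by rewrite mulmx_ebase.
have [X eX] : exists X, X = M1 *m invmx R by exists (M1 *m invmx R).
(* After the column operation [invmx R] the lower block is [b *m pid_mx l]; [Y] keeps the upper
   columns below which it vanishes. They span [V :&: E]. *)
pose Y : 'M_(s, r) := X *m copid_mx l.
pose a := col_ebase Y; pose R' := row_ebase Y; pose k := \rank Y.
have uR' : R' \in unitmx by exact: row_ebase_unit.
have ua : a \in unitmx by exact: col_ebase_unit.
have ks : (k <= s)%N by exact: rank_leq_row.
have kr : (k <= r)%N by exact: rank_leq_col.
have eY : Y = a *m pid_mx k *m R' by rewrite mulmx_ebase.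
have [Z eZ] : exists Z : 'M_(s, r), Z = pid_mx k *m R' by eexists.
(* With this choice [a *m N *m pid_mx l] is [X *m pid_mx l], which added to [Y] gives back [X]. *)
have [N eN] : exists N : 'M_(s, m), N = invmx a *m X *m pid_mx l by eexists.
have [g eg] : exists g, g = block_mx a 0 0 b *m transvec N by eexists.
have eMR : M = g *m col_mx Z (pid_mx l) *m R.
  rewrite eg mulmx_block !(mulmx0, mul0mx, mulmx1, addr0, add0r).
  rewrite mul_block_col mul0mx add0r mul_col_mx -eM2 -[LHS]vsubmxK.
  congr col_mx; rewrite -[LHS](mulmxKV uR) -eX; congr (_ *m _).
  rewrite eZ mulmxA -eY eN !mulmxA mulmxV // mul1mx -mulmxA pid_mx_id //.
  by rewrite /Y /copid_mx mulmxBr mulmx1 subrK.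
have Zpid : Z *m (pid_mx l : 'M_r) = 0.
  have : a *m Z *m (pid_mx l : 'M_r) = 0.
    by rewrite eZ mulmxA -eY /Y -mulmxA mul_copid_mx_pid // mulmx0.
  by rewrite -mulmxA => /(congr1 (mulmx (invmx a))); rewrite mulKmx // mulmx0.
have eM : colspan M = colspan (g *m stdmx F s m k l).
  (* Changes of generators in both directions. They are rectangular because [k + l = r] is only
     deduced afterwards, by comparing ranks. *)
  pose Q : 'M_(k + l, r) := col_mx (pid_mx k *m R') (pid_mx l).
  pose Q' : 'M_(r, k + l) :=
    row_mx (copid_mx l *m invmx R' *m pid_mx k) (pid_mx l).
  apply: (@colspan_eq _ _ _ _ _ _ (invmx R *m Q') (Q *m R)).
    rewrite eMR mulmxA mulmxK // -[RHS]mulmxA; congr (_ *m _).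
    rewrite mul_col_row /stdmx; congr block_mx.
    + rewrite !mulmxA /copid_mx mulmxBr mulmx1 mulmxBl Zpid mul0mx subr0.
      by rewrite eZ mulmxK // pid_mx_id.
    + have -> : (pid_mx l : 'M[F]_(r, l)) = (pid_mx l : 'M_r) *m pid_mx l.
        by rewrite pid_mx_id.
      by rewrite mulmxA Zpid mul0mx.
    + by rewrite !mulmxA mul_pid_mx_copid // !mul0mx.
    + by rewrite pid_mx_id.
  rewrite eMR mulmxA -[g *m _ *m Q]mulmxA; congr (_ *m _ *m _).
  rewrite /stdmx mul_block_col !mul0mx addr0 add0r.
  by rewrite !mulmxA !pid_mx_id // eZ.
exists k, l, a, b, N; rewrite -eg; split => //; split => //.
have ug : g \in unitmx.
  rewrite eg unitmx_mul !unitmxE det_ublock det_transvec unitr1 andbT.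
  by rewrite unitrM -!unitmxE ua.
rewrite -[RHS]rM -dim_colspan eM dim_colspan -mxrank_tr trmx_mul.
rewrite mxrankMfree; last by rewrite row_free_unit unitmx_tr.
apply/esym/eqP/row_freeP; exists (stdmx F s m k l).
exact: stdmx_linv.
Qed.

(** Divide by an [n]-th root of the determinant, available in a closed field. *)
Lemma unitmx_scale_det1 (F : numClosedFieldType) n (a : 'M[F]_n) : (0 < n)%N ->
  a \in unitmx -> exists c a', [/\ c != 0, \det a' = 1 & a = a' *m c%:M].
Proof.
move=> n_gt0; rewrite unitmxE unitfE => da.
pose c := n.-root (\det a).
have cn : c ^+ n = \det a by rewrite rootCK.
have c0 : c != 0 by apply: contraNneq da => c0; rewrite -cn c0 expr0n gtn_eqF.
exists c, (c^-1 *: a); split => //.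
  by rewrite detZ exprVn cn mulVf.
by rewrite mul_mx_scalar scalerA divff // scale1r.
Qed.

(** The scalars [c] and [d] split off from [a] and [b] pass to the right through [transvec],
    rescaling [N] by [c / d], and then through [stdmx], where they only change the basis of the same
    subspace. *)
Lemma normal_form (F : numClosedFieldType) s m r (M : 'M[F]_(s + m, r)) :
  (0 < s)%N -> (0 < m)%N -> \rank M = r ->
  exists k l (a : 'M_s) (b : 'M_m) (N : 'M_(s, m)),
    [/\ [/\ (k <= s)%N, (l <= m)%N & (k + l)%N = r],
        \det a = 1, \det b = 1 &
        colspan M = colspan (block_mx a 0 0 b *m transvec N *m stdmx F s m k l)].
Proof.
move=> s0 m0 /normal_form_GL[k [l [a [b [N [kl ua ub eM]]]]]].
have [c [a' [c0 da' ea]]] := unitmx_scale_det1 s0 ua.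
have [d [b' [d0 db' eb]]] := unitmx_scale_det1 m0 ub.
exists k, l, a', b', ((c * d^-1) *: N); split => //; rewrite eM.
pose D j1 j2 x y : 'M[F]_(j1 + j2) := block_mx x%:M 0 0 y%:M.
have DV j1 j2 : D j1 j2 c d *m D j1 j2 c^-1 d^-1 = 1%:M.
  rewrite /D mulmx_block !(mulmx0, mul0mx, addr0, add0r) -!scalar_mxM.
  by rewrite !divff // -scalar_mx_block.
have e : block_mx a 0 0 b *m transvec N *m stdmx F s m k l =
    block_mx a' 0 0 b' *m transvec (c * d^-1 *: N) *m stdmx F s m k l *m D k l c d.
  rewrite -[RHS]mulmxA -mulmx_diag_stdmx mulmxA; congr (_ *m _).
  rewrite ea eb !mulmx_block !(mulmx0, mul0mx, mulmx1, addr0, add0r).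
  congr block_mx; rewrite !mul_mx_scalar -!scalemxAl -!scalemxAr scalerA.
  by rewrite mulrCA mulrV ?unitfE // mulr1.
by apply: (colspan_eq (Q := D k l c^-1 d^-1) _ e); rewrite e -[RHS]mulmxA DV mulmx1.
Qed.

End NormalForm.

(** * Necessary conditions for an invariant section not to vanish *)

Section Instability.
Local Open Scope ring_scope.

Lemma regular_affine_curve (F : fieldType) n e (f : 'M[F]_n -> F) (A B : 'M[F]_n) :
  regular_on_SL f -> (forall t : F, SL (A + t ^+ e *: B)) ->
  exists q : {poly F}, forall t, f (A + t ^+ e *: B) = q.[t].
Proof.
case=> q fq SLAB.
exists (\sum_(m <- msupp q) (mcoeff m q)%:P *
   \prod_i ((mxvec A 0 i)%:P + (mxvec B 0 i)%:P * 'X^e) ^+ (m : multinom _) i).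
move=> t; rewrite fq // mevalE horner_sum; apply: eq_bigr => m _.
rewrite hornerM hornerC horner_prod; congr (_ * _); apply: eq_bigr => i _.
rewrite horner_exp hornerD hornerC hornerM hornerC hornerXn.
by rewrite linearD linearZ !mxE mulrC.
Qed.

(** In characteristic zero, [1, ..., size q] are distinct nonzero roots: too many. *)
Lemma poly_eq0_off0 (F : numFieldType) (q : {poly F}) :
  (forall t, t != 0 -> q.[t] = 0) -> q = 0.
Proof.
move=> q0; apply: (@roots_geq_poly_eq0 _ q [seq i.+1%:R | i <- iota 0 (size q)]).
- apply/allP => _ /mapP[i _ ->]; apply/eqP/q0; by rewrite pnatr_eq0.
- rewrite map_inj_uniq ?iota_uniq // => i j /eqP; rewrite eqr_nat.
  by rewrite eqSS => /eqP.
- by rewrite size_map size_iota.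
Qed.

(* [lambda t] moves [g] to [h (1 + t^n N) g1] up to an element of the parabolic
   on which the character has value [t^(m k - s l)], so the value of an invariant
   section at [g] is this power of [t] times a polynomial in [t]. *)
Lemma invariant_section_poly (F : numFieldType) s m k l d (f : 'M[F]_(s + m) -> F) g
    (a : 'M_s) (b : 'M_m) N :
  (k <= s)%N -> (l <= m)%N ->
  line_bundle_section (k + l) d f -> lambda_invariant s f -> SL g ->
  \det a = 1 -> \det b = 1 ->
  colspan (g *m (pid_mx (k + l) : 'M_(s + m, k + l))) =
    colspan (block_mx a 0 0 b *m transvec N *m stdmx F s m k l) ->
  exists q : {poly F},
    [/\ forall t, t != 0 -> f g * t ^+ (s * l * d) = t ^+ (m * k * d) * q.[t]
     &  N = 0 -> forall t, q.[t] = f g].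
Proof.
move=> ks lm [freg fequi] finv SLg da db eV.
have le_r : (k + l <= s + m)%N by rewrite leq_add.
pose h := block_mx a 0 0 b.
have dh : \det h = 1 by rewrite det_ublock da db mulr1.
pose u := transvec N.
have uhu : h *m u \in unitmx.
  by rewrite unitmxE det_mulmx dh det_transvec mulr1 unitr1.
have [g1 eg1] : exists g1, g1 = invmx (h *m u) *m g by eexists.
have eg : g = h *m u *m g1 by rewrite eg1 mulKVmx.
have SLg1 : \det g1 = 1.
  by rewrite -SLg eg !det_mulmx dh det_transvec !mul1r.
have ug1 : g1 \in unitmx by rewrite unitmxE SLg1 unitr1.
pose J : 'M[F]_(s + m, k + l) := pid_mx (k + l).
pose W := stdmx F s m k l.
have WK : W^T *m W = 1%:M by exact: stdmx_linv.
(* [g1] carries the base point to the standard subspace, with change of basis [Q]. *)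
have [Q eQ] : exists Q, g1 *m J = W *m Q.
  have /colspan_subP[Q eQ] : (colspan (g *m J) <= colspan (h *m u *m W))%VS.
    by rewrite eV.
  by exists Q; apply: (can_inj (mulKmx uhu)); rewrite mulmxA -eg eQ mulmxA.
have uQ : Q \in unitmx.
  have /colspan_subP[Q' eQ'] : (colspan (h *m u *m W) <= colspan (g *m J))%VS.
    by rewrite eV.
  have : W = W *m (Q *m Q').
    rewrite mulmxA -eQ; apply: (can_inj (mulKmx uhu)).
    by rewrite eQ' eg !mulmxA.
  move/(congr1 (mulmx W^T)); rewrite mulmxA WK mul1mx => /esym /mulmx1_unit.
  by case.
have curve t : h *m g1 + t ^+ (s + m) *: (h *m block_mx 0 N 0 0 *m g1) =
    h *m transvec (t ^+ (s + m) *: N) *m g1.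
  rewrite scalemxAl scalemxAr -mulmxDl -{1}[h]mulmx1 -mulmxDr scale_block_mx.
  by rewrite !scaler0 [1%:M]scalar_mx_block add_block_mx !addr0 !add0r.
have [q fq] : exists q : {poly F}, forall t,
    f (h *m g1 + t ^+ (s + m) *: (h *m block_mx 0 N 0 0 *m g1)) = q.[t].
  apply: regular_affine_curve => // t.
  by rewrite curve /SL /= !det_mulmx det_transvec SLg1 dh !mulr1.
have qE t : q.[t] = f (h *m transvec (t ^+ (s + m) *: N) *m g1).
  by rewrite -fq curve.
exists q; split=> [t t0|N0 t]; last first.
  by rewrite qE eg /u N0 scaler0.
pose L := lambda (s + m) s t.
(* Since [L] preserves the standard subspace, its conjugate [D] fixes the base point, where it acts
   by a conjugate of [Dt]. *)
pose D := invmx g1 *m L *m g1.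
pose Dt : 'M[F]_(k + l) := block_mx (t ^+ m)%:M 0 0 (t ^- s)%:M.
have dL : \det L = 1 by exact: det_lambda.
have SLD : SL D.
  by rewrite /SL /= /D !det_mulmx dL mulr1 -det_mulmx mulVmx // det1.
have DJ : D *m J = J *m (invmx Q *m Dt *m Q).
  rewrite /D -mulmxA eQ -!mulmxA; apply: (can_inj (mulKmx ug1)).
  rewrite mulKVmx // [L *m _]mulmxA /L lambdaE mulmx_diag_stdmx.
  by rewrite [RHS]mulmxA eQ -!mulmxA mulKVmx.
have [pD wD] := parabolic_pid le_r SLD DJ.
have dDt : \det (invmx Q *m Dt *m Q) = t ^+ (m * k) * t ^- (s * l).
  rewrite !det_mulmx mulrAC -det_mulmx mulVmx // det1 mul1r det_ublock.
  by rewrite !det_scalar -!exprVn -!exprM.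
have -> : f g = (t ^+ (m * k) * t ^- (s * l)) ^+ d * q.[t].
  rewrite -(finv t) // eg -dDt -wD qE -fequi //; last first.
    by rewrite /SL /= !det_mulmx det_transvec SLg1 dh !mulr1.
  (* The identity is [L *m h *m u *m g1 = h *m u' *m g1 *m D], with [u'] the transvection of
     [t ^+ (s + m) *: N]. *)
  congr f; rewrite !mulmxA lambda_levi -[X in X *m _ = _]mulmxA.
  rewrite lambda_transvec // -!mulmxA; congr (_ *m (_ *m _)).
  by rewrite /D !mulmxA mulmxV // mul1mx.
by rewrite exprMn exprVn -!exprM mulrAC [t ^+ (m * k * d) / _ * _]mulfVK ?expf_neq0.
Qed.

(** Compare coefficients in [f(g) t^(s l d) = t^(m k d) q(t)]. If [s l < m k], the right side has no
    term of degree [s l d], so [f g = 0]. If [N = 0], then [q] is the constant [f g] and the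
    exponents agree; this clause later excludes the point [wP/P]. *)
Lemma section_weight_le (F : numFieldType) s m k l d (f : 'M[F]_(s + m) -> F) g
    (a : 'M_s) (b : 'M_m) N :
  (k <= s)%N -> (l <= m)%N -> (0 < d)%N ->
  line_bundle_section (k + l) d f -> lambda_invariant s f -> SL g -> f g != 0 ->
  \det a = 1 -> \det b = 1 ->
  colspan (g *m (pid_mx (k + l) : 'M_(s + m, k + l))) =
    colspan (block_mx a 0 0 b *m transvec N *m stdmx F s m k l) ->
  (m * k <= s * l)%N /\ (N = 0 -> (m * k = s * l)%N).
Proof.
move=> ks lm d0 secf finv SLg fg0 da db eV.
have [q [fgq qN0]] := invariant_section_poly ks lm secf finv SLg da db eV.
have e : (f g)%:P * 'X^(s * l * d) - 'X^(m * k * d) * q = 0.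
  apply: poly_eq0_off0 => t t0.
  by rewrite hornerD hornerN !hornerM hornerC !hornerXn fgq // subrr.
have le : (m * k <= s * l)%N.
  rewrite leqNgt; apply: contra fg0 => lt.
  move/(congr1 (coefp (s * l * d))): e; rewrite /= coefB coefCM coefXn eqxx mulr1.
  by rewrite coefXnM ltn_pmul2r // lt subr0 coef0 => ->.
split=> // N0; apply/eqP; rewrite eqn_leq le leqNgt; apply: contra fg0 => lt.
have qc : q = (f g)%:P.
  apply/eqP; rewrite -subr_eq0; apply/eqP/poly_eq0_off0 => t _.
  by rewrite hornerD hornerN hornerC qN0 // subrr.
move/(congr1 (coefp (m * k * d))): e; rewrite /= coefB coefCM coefXn qc.
rewrite coefXnM ltnn subnn coefC eqxx eqn_pmul2r // ltn_eqF // mulr0 sub0r.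
by rewrite coef0 => /eqP; rewrite oppr_eq0.
Qed.

End Instability.

(** * Generalized Plücker coordinates and construction of invariant sections *)

Section Minors.
Local Open Scope ring_scope.

Variable F : fieldType.

(** A Plücker coordinate when the rows of [A] are standard basis vectors, and in general a linear
    combination of these, which can be adapted to a given point. *)
Definition gminor n r (A : 'M[F]_(r, n)) (g : 'M[F]_n) : F :=
  \det (A *m g *m (pid_mx r : 'M_(n, r))).

Lemma regular_gminor n r (A : 'M[F]_(r, n)) : regular_on_SL (gminor A).
Proof.
exists (\det (map_mx (@mpolyC (n * n) F) A *m
  (\matrix_(i, j) mpolyX F (mnm1 (mxvec_index i j))) *m (pid_mx r : 'M_(n, r)))).
move=> g _; rewrite -det_map_mx !map_mxM map_pid_mx /gminor.
congr (\det (_ *m _ *m _)); apply/matrixP => i j; rewrite !mxE /=.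
  by rewrite mevalC.
by rewrite mevalXU mxvecE.
Qed.

Lemma regular_mul n (f1 f2 : 'M[F]_n -> F) :
  regular_on_SL f1 -> regular_on_SL f2 -> regular_on_SL (fun g => f1 g * f2 g).
Proof.
move=> [q1 e1] [q2 e2]; exists (q1 * q2) => g SLg.
by rewrite mevalM e1 // e2.
Qed.

Lemma regular_exp n (f : 'M[F]_n -> F) d :
  regular_on_SL f -> regular_on_SL (fun g => f g ^+ d).
Proof. by move=> [q e]; exists (q ^+ d) => g SLg; rewrite rmorphXn /= e. Qed.

Lemma gminor_parabolic n r (A : 'M[F]_(r, n)) g p : (r <= n)%N ->
  parabolic F n r p -> gminor A (g *m p) = fund_weight r p * gminor A g.
Proof.
move=> rn /(fund_weight_pid rn)[T eT ->]; rewrite /gminor.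
by rewrite -!mulmxA eT !mulmxA det_mulmx mulrC.
Qed.

Lemma gminor_section n r d1 d2 (A1 A2 : 'M[F]_(r, n)) : (r <= n)%N ->
  line_bundle_section r (d1 + d2) (fun g => gminor A1 g ^+ d1 * gminor A2 g ^+ d2).
Proof.
move=> rn; split.
  by apply: regular_mul; apply: regular_exp; exact: regular_gminor.
move=> g p _ pp; rewrite !gminor_parabolic // !exprMn exprD.
by rewrite mulrACA.
Qed.

(** Complete a basis of the row space of [M1] by a basis of the complement [M2 :\: M1]. *)
Lemma row_free_complement m1 m2 r (M1 : 'M[F]_(m1, r)) (M2 : 'M[F]_(m2, r)) :
  \rank (col_mx M1 M2) = r ->
  exists l (A1 : 'M_(\rank M1, m1)) (A2 : 'M_(l, m2)),
    (\rank M1 + l)%N = r /\ row_free (col_mx (A1 *m M1) (A2 *m M2)).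
Proof.
move=> rM; pose B := (M2 :\: M1)%MS.
have /submxP[A1 eA1] : (row_base M1 <= M1)%MS by rewrite eq_row_base.
have /submxP[A2 eA2] : (row_base B <= M2)%MS by rewrite eq_row_base diffmxSl.
have e : (M1 + B :=: col_mx M1 M2)%MS.
  apply/eqmxP; rewrite -!addsmxE addsmxS ?diffmxSl //= addsmx_sub addsmxSl /=.
  rewrite -(addsmx_diff_cap_eq M2 M1) addsmx_sub addsmxSr /=.
  by rewrite (submx_trans (capmxSr _ _)) // addsmxSl.
have dB : (M1 :&: B = 0)%MS by rewrite capmxC capmx_diff.
have rB : (\rank M1 + \rank B)%N = r.
  by apply: etrans rM; rewrite -e mxrank_disjoint_sum.
exists (\rank B), A1, A2; split=> //.
rewrite -eA1 -eA2 /row_free -addsmxE.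
by rewrite (adds_eqmx (eq_row_base M1) (eq_row_base B)) e rM rB.
Qed.

(** For block-diagonal [A], the two scalars of [lambda] move to the left of [A] and act on [k] and
    [l] rows respectively. *)
Lemma exists_gminor s m k l r (g : 'M[F]_(s + m)) (A1 : 'M_(k, s)) (A2 : 'M_(l, m)) :
  let M := g *m (pid_mx r : 'M_(s + m, r)) in
  (k + l)%N = r -> row_free (col_mx (A1 *m usubmx M) (A2 *m dsubmx M)) ->
  exists A : 'M_(r, s + m), gminor A g != 0 /\
    forall t g', t != 0 ->
      gminor A (lambda (s + m) s t *m g') = t ^+ (m * k) / t ^+ (s * l) * gminor A g'.
Proof.
move=> M kl; subst r => rf; exists (block_mx A1 0 0 A2); split.
  rewrite /gminor -mulmxA -/M -[M]vsubmxK mul_block_col !mul0mx addr0 add0r.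
  by rewrite -unitfE -unitmxE -row_free_unit.
move=> t g' t0; rewrite /gminor !mulmxA lambdaE.
have -> : block_mx A1 0 0 A2 *m block_mx (t ^+ m)%:M 0 0 (t ^- s)%:M =
   block_mx (t ^+ m)%:M 0 0 (t ^- s)%:M *m block_mx A1 0 0 A2.
  rewrite !mulmx_block !(mulmx0, mul0mx, addr0, add0r).
  by rewrite !mul_scalar_mx !mul_mx_scalar.
rewrite -!mulmxA det_mulmx !mulmxA; congr (_ * _).
by rewrite det_ublock !det_scalar -!exprVn -!exprM.
Qed.

(** One minor takes as many rows as possible from the upper block, the other from the lower block.
    With [n = s + m], their weights are [n k1 - r s >= 0] and [n k2 - r s < 0], because [k1 > k] and
    [k2 <= k]. *)
Lemma semistable_of_ranks s m r k (g : 'M[F]_(s + m)) :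
  let M := g *m (pid_mx r : 'M_(s + m, r)) in
  SL g -> (0 < s)%N -> (0 < m)%N -> (r <= s + m)%N ->
  (r <= \rank (dsubmx M) + k)%N -> (k < \rank (usubmx M))%N ->
  ((s + m) * k < r * s)%N -> (r * s <= (s + m) * k.+1)%N ->
  semistable F r (s + m) s (mxact g (base_point F r (s + m))).
Proof.
move=> M SLg s0 m0 rn rk2 rk1 lk gk.
have ug : g \in unitmx by rewrite unitmxE SLg unitr1.
have rM : \rank M = r.
  rewrite /M -mxrank_tr trmx_mul mxrankMfree; last first.
    by rewrite row_free_unit unitmx_tr.
  by rewrite mxrank_tr rank_pid_mx.
rewrite /semistable /grassmannian /=; split.
  by rewrite base_pointE mxact_colspan dim_colspan.
have rcM : \rank (col_mx (usubmx M) (dsubmx M)) = r by rewrite vsubmxK.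
have rcM' : \rank (col_mx (dsubmx M) (usubmx M)) = r.
  by rewrite -addsmxE addsmxC addsmxE.
have [l1 [A1 [A2 [e1 rf1]]]] := row_free_complement rcM.
have [k2 [B2 [B1 [e2 rf2]]]] := row_free_complement rcM'.
have {}rf2 : row_free (col_mx (B1 *m usubmx M) (B2 *m dsubmx M)).
  by move: rf2; rewrite /row_free -!addsmxE addsmxC addnC.
have [A [nzA wA]] := exists_gminor e1 rf1.
have [B [nzB wB]] := exists_gminor (etrans (addnC _ _) e2) rf2.
set k1 := \rank (usubmx M) in A1 e1 rk1 rf1 wA.
set l2 := \rank (dsubmx M) in B2 e2 rk2 rf2 wB.
have c1 : (s * l1 <= m * k1)%N by nia.
have c2 : (m * k2 < s * l2)%N by nia.
(* Each minor is raised to the absolute weight of the other, so the weights cancel; strictness in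
   [c2] makes the degree positive. *)
exists (s * l2 - m * k2 + (m * k1 - s * l1))%N.
exists (fun g => gminor A g ^+ (s * l2 - m * k2) * gminor B g ^+ (m * k1 - s * l1)).
split.
- by rewrite addn_gt0 subn_gt0 c2.
- exact: gminor_section.
- move=> t g' t0 _; rewrite wA // wB //.
  have -> : t ^+ (m * k1) / t ^+ (s * l1) = t ^+ (m * k1 - s * l1).
    by rewrite -[in LHS](subnK c1) exprD mulfK ?expf_neq0.
  have -> : t ^+ (m * k2) / t ^+ (s * l2) = t ^- (s * l2 - m * k2).
    rewrite -[in t ^- (s * l2)](subnK (ltnW c2)) exprD invfM mulrCA divff ?mulr1 //.
    exact: expf_neq0.
  rewrite !exprMn mulrACA -[RHS]mul1r -exprVn -!exprM mulnC -exprMn.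
  by rewrite divff ?expr1n.
- by exists g; split => //; rewrite mulf_neq0 ?expf_neq0.
Qed.

End Minors.

(** * The permutation [w_elt] and its torus-fixed point *)

Section CosetRepresentative.
Local Open Scope nat_scope.

Lemma simple_refl_fix n i (x : 'I_n) : x != i.-1 :> nat -> x != i :> nat ->
  simple_refl n i x = x.
Proof.
rewrite /simple_refl; case: insubP => [a _ ea|_]; last by rewrite perm1.
case: insubP => [b _ eb|_]; last by rewrite perm1.
by move=> xa xb; rewrite tpermD // -val_eqE /= ?ea ?eb eq_sym.
Qed.

Lemma simple_refl_top n i (x : 'I_n) : x = i :> nat ->
  simple_refl n i x = i.-1 :> nat.
Proof.
move=> xi; rewrite /simple_refl; case: insubP => [a _ ea|].
  case: insubP => [b _ eb|]; last by rewrite -xi ltn_ord.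
  by have -> : x = b; [apply: val_inj; rewrite /= eb | rewrite tpermR].
by rewrite -xi (leq_ltn_trans (leq_pred _)).
Qed.

(** One bracket of [w_elt]. For [L <= a < n] it is a cycle: with factors applied from left to right,
    it carries [a] down to [a - L] and moves the positions [a - L, ..., a - 1] up by one. *)
Definition refl_block n a L : 'S_n := (\prod_(k < L) simple_refl n (a - k))%g.

Lemma refl_block_fix n a L (x : 'I_n) : (x < a - L) || (a < x) ->
  refl_block n a L x = x.
Proof.
elim: L => [|L IHL] hx; first by rewrite /refl_block big_ord0 perm1.
rewrite /refl_block big_ord_recr permM -/(refl_block n a L) IHL; last by lia.
by apply: simple_refl_fix => /=; lia.
Qed.

Lemma refl_block_top n a L (x : 'I_n) : L <= a -> x = a :> nat ->
  refl_block n a L x = a - L :> nat.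
Proof.
elim: L => [|L IHL] La xa; first by rewrite /refl_block big_ord0 perm1 subn0.
rewrite /refl_block big_ord_recr permM -/(refl_block n a L).
rewrite (simple_refl_top (i := a - L)); last by rewrite IHL // ltnW.
by lia.
Qed.

Definition refl_blocks n p s J : 'S_n := (\prod_(j < J) refl_block n (s + j) (s - p))%g.

Lemma refl_blocksS n p s J x :
  refl_blocks n p s J.+1 x = refl_block n (s + J) (s - p) (refl_blocks n p s J x).
Proof. by rewrite /refl_blocks big_ord_recr permM. Qed.

Lemma refl_blocks_fix n p s J (x : 'I_n) : p <= s -> (x < p) || (s + J <= x) ->
  refl_blocks n p s J x = x.
Proof.
move=> ps; elim: J => [|J IHJ] hx; first by rewrite /refl_blocks big_ord0 perm1.
by rewrite refl_blocksS IHJ; [apply: refl_block_fix; lia | lia].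
Qed.

(** The brackets before number [j] do not touch [s + j], bracket [j] brings it to [p + j], and the
    later ones only move larger positions. *)
Lemma refl_blocks_shift n p s J (x : 'I_n) : p <= s -> s <= x < s + J ->
  refl_blocks n p s J x = x - s + p :> nat.
Proof.
move=> ps; elim: J => [|J IHJ] hx; first by lia.
rewrite refl_blocksS; have [xJ|xJ] := eqVneq (x : nat) (s + J).
  rewrite refl_blocks_fix //; last by lia.
  by rewrite refl_block_top //; lia.
have /IHJ e : s <= x < s + J by lia.
by rewrite refl_block_fix e //; lia.
Qed.

(** By injectivity: all values below [p + J] are already taken, by the fixed positions below [p] and
    by the shifted ones. *)
Lemma refl_blocks_high n p s J (x : 'I_n) : p <= s -> s + J <= n ->
  (p <= x < s) || (s + J <= x) -> p + J <= refl_blocks n p s J x.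
Proof.
move=> ps sJ hx; rewrite leqNgt; apply/negP => lt.
have [lp|pl] := ltnP (refl_blocks n p s J x) p.
  have e := @refl_blocks_fix n p s J (refl_blocks n p s J x) ps.
  have /perm_inj ex := e (introT orP (or_introl lp)).
  by move: lp; rewrite ex; lia.
have hy : refl_blocks n p s J x - p + s < n by lia.
have ey : refl_blocks n p s J (Ordinal hy) = refl_blocks n p s J x.
  by apply: val_inj; rewrite /= refl_blocks_shift //=; lia.
by move/perm_inj/(congr1 val): ey => /=; lia.
Qed.

Lemma torus_point_w_elt (F : fieldType) s m p l : p <= s -> l <= m ->
  torus_point F (p + l) (w_elt (s + m) p s (p + l)) = colspan (stdmx F s m p l).
Proof.
move=> ps lm; rewrite /torus_point base_pointE mxact_colspan; congr colspan.
have -> : w_elt (s + m) p s (p + l) = refl_blocks (s + m) p s l.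
  by rewrite /w_elt addKn.
(* Row [x] of the product is row [w x] of [pid_mx], so each block only requires the position of
   [w x]. *)
rewrite -row_permE; apply/matrixP => x j; rewrite [LHS]mxE [LHS]mxE.
rewrite -[x]splitK -[j]splitK /stdmx.
case: (split x) => x' /=; case: (split j) => j' /=; set y := refl_blocks _ _ _ _ _.
- rewrite block_mxEul mxE; have [xp|px] := ltnP x' p.
    by rewrite /y refl_blocks_fix ?xp //= ltn_addr // xp.
  have hy : p + l <= y by apply: refl_blocks_high => //=; have := ltn_ord x'; lia.
  by rewrite andbF ltnNge hy andbF.
- rewrite block_mxEur mxE; have [xp|px] := ltnP x' p.
    by rewrite /y refl_blocks_fix ?xp //= ltn_eqF // ltn_addr.
  have hy : p + l <= y by apply: refl_blocks_high => //=; have := ltn_ord x'; lia.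
  by rewrite ltnNge hy andbF.
- rewrite block_mxEdl mxE; have [xl|lx] := ltnP x' l.
    have ey : y = x' + p :> nat by rewrite /y refl_blocks_shift //=; lia.
    by rewrite ey gtn_eqF // (leq_trans (ltn_ord j')) // leq_addl.
  have hy : p + l <= y by apply: refl_blocks_high => //=; have := ltn_ord x'; lia.
  by rewrite ltnNge hy andbF.
- rewrite block_mxEdr mxE; have [xl|lx] := ltnP x' l.
    have ey : y = p + x' :> nat by rewrite /y refl_blocks_shift //=; lia.
    by rewrite ey eqn_add2l ltn_add2l xl andbT.
  have hy : p + l <= y by apply: refl_blocks_high => //=; have := ltn_ord x'; lia.
  by rewrite ltnNge hy !andbF.
Qed.

End CosetRepresentative.

(** * Ranks on the Schubert cell and the two inclusions *)

Section SemistableLocus.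
Local Open Scope ring_scope.

Lemma triangular_pid (F : fieldType) n q (b : 'M[F]_n) : (q <= n)%N ->
  (forall i j : 'I_n, (j < i)%N -> b i j = 0) -> b \in unitmx ->
  exists2 T : 'M_q, T \in unitmx &
    b *m (pid_mx q : 'M_(n, q)) = pid_mx q *m T.
Proof.
move=> qn bT; have e : n = (q + (n - q))%N by rewrite subnKC.
move: (n - q)%N e => q' e; subst n => ub.
have dl0 : dlsubmx b = 0.
  by apply/matrixP => i j; rewrite !mxE bT //= (leq_trans (ltn_ord j)) ?leq_addr.
exists (ulsubmx b).
  move: ub; rewrite !unitmxE -[b in \det b]submxK dl0 det_ublock unitrM.
  by case/andP.
rewrite -{1}[b]submxK dl0 pid_mx_col mul_block_col mul_col_mx.
by rewrite !mulmx0 !mulmx1 !addr0 mul1mx mul0mx.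
Qed.

Lemma borel_transvec (F : fieldType) s m (N : 'M[F]_(s, m)) :
  borel F (s + m) (transvec N).
Proof.
split; first exact: det_transvec.
move=> x y; rewrite -[x]splitK -[y]splitK /transvec.
case: (split x) => i' /=; case: (split y) => j' /= ji.
- by rewrite block_mxEul mxE -val_eqE gtn_eqF.
- by have := ltn_ord i'; lia.
- by rewrite block_mxEdl mxE.
- by rewrite block_mxEdr mxE -val_eqE gtn_eqF //; move: ji; rewrite ltn_add2l.
Qed.

Lemma mxactM (F : fieldType) n (g h : 'M[F]_n) m (M : 'M_(n, m)) :
  mxact g (mxact h (colspan M)) = mxact (g *m h) (colspan M).
Proof. by rewrite !mxact_colspan mulmxA. Qed.

(** Scalar matrices fix every subspace, so the determinant of [perm_mx w] can be normalized. *)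
Lemma torus_point_SL (F : numClosedFieldType) r n (w : 'S_n) : (0 < n)%N ->
  exists2 w' : 'M[F]_n, SL w' & torus_point F r w = mxact w' (base_point F r n).
Proof.
move=> n0.
have [c [w' [c0 dw' ew]]] := unitmx_scale_det1 n0 (unitmx_perm F w).
exists w' => //; rewrite /torus_point ew base_pointE !mxact_colspan.
set J := pid_mx r.
have e : w' *m c%:M *m J = w' *m J *m c%:M by rewrite -!mulmxA scalar_mxC.
apply: (@colspan_eq _ _ _ _ _ _ c^-1%:M c%:M) => //.
by rewrite e -[RHS]mulmxA -scalar_mxM divff // mulmx1.
Qed.

(** The Levi factor preserves both ranks. The projection to [E] contains the span of [X], of
    dimension [k]; if it is no larger, the columns of [Y] lie in that span, which triangularity
    identifies with that of [e_1, ..., e_k], and [b] fixes the standard subspace. *)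
Lemma schubert_cell_ranks (F : fieldType) s m k l (a b : 'M[F]_(s + m)) :
  (k <= s)%N -> (l <= m)%N -> levi_ss F (s + m) s a -> borel F (s + m) b ->
  colspan (b *m stdmx F s m k l) <> colspan (stdmx F s m k l) ->
  let M := a *m b *m stdmx F s m k l in
  (l <= \rank (dsubmx M))%N /\ (k < \rank (usubmx M))%N.
Proof.
move=> ks lm /levi_ssP[a1 [a2 [da1 da2 ->]]] [SLb bT] neq M.
pose b1 := ulsubmx b; pose b2 := drsubmx b; pose c := ursubmx b.
have eb : b = block_mx b1 c 0 b2.
  rewrite -[LHS]submxK; congr block_mx; apply/matrixP => i j; rewrite !mxE bT //=.
  by rewrite (leq_trans (ltn_ord j)) ?leq_addr.
have : b \in unitmx by rewrite unitmxE SLb unitr1.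
rewrite unitmxE eb det_ublock unitrM -!unitmxE => /andP[ub1 ub2].
have b1T (i j : 'I_s) : (j < i)%N -> b1 i j = 0.
  by move=> ji; rewrite !mxE bT.
have b2T (i j : 'I_m) : (j < i)%N -> b2 i j = 0.
  by move=> ji; rewrite !mxE bT //= ltn_add2l.
have [T1 uT1 eT1] := triangular_pid ks b1T ub1.
have [T2 uT2 eT2] := triangular_pid lm b2T ub2.
have ua1 : a1 \in unitmx by rewrite unitmxE da1 unitr1.
have ua2 : a2 \in unitmx by rewrite unitmxE da2 unitr1.
pose X := b1 *m (pid_mx k : 'M_(s, k)); pose Y := c *m (pid_mx l : 'M_(m, l)).
have ebW : b *m stdmx F s m k l = block_mx X Y 0 (b2 *m pid_mx l).
  by rewrite eb mulmx_block !(mulmx0, mul0mx, addr0, add0r).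
have eM : M = block_mx (a1 *m X) (a1 *m Y) 0 (a2 *m (b2 *m pid_mx l)).
  by rewrite /M -mulmxA ebW mulmx_block !(mulmx0, mul0mx, addr0, add0r).
have rank_unit n q (u : 'M[F]_n) (A : 'M_(n, q)) :
    u \in unitmx -> \rank (u *m A) = \rank A.
  move=> uu; rewrite -mxrank_tr trmx_mul mxrankMfree ?mxrank_tr //.
  by rewrite row_free_unit unitmx_tr.
split.
  have : (\rank (dsubmx M *m col_mx 0 1%:M) <= \rank (dsubmx M))%N.
    exact: mxrankM_maxl.
  rewrite eM block_mxEv col_mxKd mul_row_col mulmx0 add0r mulmx1 !rank_unit //.
  by rewrite rank_pid_mx.
rewrite eM block_mxEv col_mxKu -mul_mx_row rank_unit // ltnNge; apply/negP => rk.
have sX : (colspan X <= colspan (row_mx X Y))%VS.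
  by apply/colspan_subP; exists (col_mx 1%:M 0); rewrite mul_row_col mulmx0 addr0 mulmx1.
have eX : colspan X = colspan (row_mx X Y).
  apply/eqP; rewrite eqEdim sX !dim_colspan /= (leq_trans rk) //.
  by rewrite /X rank_unit // rank_pid_mx.
have /colspan_subP[Z eZ] : (colspan Y <= colspan X)%VS.
  rewrite eX; apply/colspan_subP; exists (col_mx 0 1%:M).
  by rewrite mul_row_col mulmx0 add0r mulmx1.
apply: neq; rewrite ebW.
pose T := block_mx T1 (T1 *m Z) 0 T2.
have uT : T \in unitmx by rewrite unitmxE det_ublock unitrM -!unitmxE uT1.
have eT : block_mx X Y 0 (b2 *m pid_mx l) = stdmx F s m k l *m T.
  rewrite /T mulmx_block !(mulmx0, mul0mx, addr0, add0r) eZ /X eT1 eT2.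
  by rewrite mulmxA.
by apply: (colspan_eq (Q := invmx T) _ eT); rewrite eT mulmxK.
Qed.

Lemma semistable_eq (F : numClosedFieldType) s m r p :
  (0 < s)%N -> (0 < m)%N -> (p <= s)%N -> (p <= r)%N -> (r - p <= m)%N ->
  ((s + m) * p < r * s)%N -> (r * s < (s + m) * p.+1)%N ->
  p = 0%N \/ r = (p + m)%N ->
  semistable F r (s + m) s =
    translates (levi_ss F (s + m) s)
      (schubert_cell F r (w_elt (s + m) p s r)
        `\` [set torus_point F r (w_elt (s + m) p s r)]).
Proof.
move=> s0 m0 ps pr lm gp lp hcase.
have [l el] : exists l, r = (p + l)%N by exists (r - p)%N; rewrite subnKC.
have {}lm : (l <= m)%N by rewrite -(addKn p l) -el.
have eW : torus_point F r (w_elt (s + m) p s r) = colspan (stdmx F s m p l).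
  by rewrite el torus_point_w_elt.
rewrite /schubert_cell eW; apply/seteqP; split=> V.
- case=> _ [d [f [d0 secf finv [g [SLg eV fg0]]]]].
  have ug : g \in unitmx by rewrite unitmxE SLg unitr1.
  have rg : \rank (g *m (pid_mx r : 'M_(s + m, r))) = r.
    rewrite -mxrank_tr trmx_mul mxrankMfree; last first.
      by rewrite row_free_unit unitmx_tr.
    by rewrite mxrank_tr rank_pid_mx //; lia.
  have [k [l' [a [b [N [[ks l'm ekl] da db eN]]]]]] := normal_form s0 m0 rg.
  have eVg : V = colspan (g *m (pid_mx r : 'M_(s + m, r))).
    by rewrite eV base_pointE mxact_colspan.
  (* Stated for any [N'], since it serves both for [N] and, to exclude [wP/P], for [0]. *)
  have weight N' : V = colspan (block_mx a 0 0 b *m transvec N' *m stdmx F s m k l') ->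
      (m * k <= s * l')%N /\ (N' = 0 -> (m * k = s * l')%N).
    move=> eVN; move: eVg secf rg; clear - ekl ks l'm d0 finv SLg fg0 da db eVN.
    subst r => eVg secf _.
    by apply: section_weight_le secf finv SLg fg0 da db _ => //; rewrite -eVg.
  have [wk _] := weight N (etrans eVg eN).
  (* The weight bound gives [(s + m) k <= r s], hence [k <= p]; conversely [p <= k] because [p = 0],
     or [l' <= m] and [r = p + m]. *)
  have kp : k = p by nia.
  have l'l : l' = l by lia.
  subst k l'.
  exists (block_mx a 0 0 b); first by apply/levi_ssP; exists a, b.
  exists (mxact (transvec N) (colspan (stdmx F s m p l))); last first.
    by rewrite mxactM mxact_colspan eVg eN.
  split; first by exists (transvec N); [exact: borel_transvec | eexists].
  (* If the point of the cell were [wP/P], the clause for [N' = 0] would give [m p = s l], that is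
     [(s + m) p = r s], against [gp]. *)
  move=> /= eU; have [|_ /(_ erefl)] := weight 0; last by nia.
  by rewrite transvec0 mulmx1 -mxact_colspan -eU mxactM mxact_colspan eVg eN.
- case=> h lh [U [[b bb [_ -> ->]] neq] ->].
  have [w' SLw' ew'] := torus_point_SL F r (w_elt (s + m) p s r) (ltn_addr m s0).
  have SLh : SL h.
    by case/levi_ssP: lh => a1 [a2 [d1 d2 ->]]; rewrite /SL /= det_ublock d1 d2 mulr1.
  have [SLb _] := bb.
  have eg : colspan (h *m b *m stdmx F s m p l) =
      colspan (h *m b *m w' *m (pid_mx r : 'M_(s + m, r))).
    rewrite -mxact_colspan -eW ew' base_pointE !mxact_colspan !mulmxA //.
  have -> : mxact h (mxact b (colspan (stdmx F s m p l))) =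
      mxact (h *m b *m w') (base_point F r (s + m)).
    by rewrite mxactM mxact_colspan eg base_pointE mxact_colspan.
  have /(schubert_cell_ranks ps lm lh bb)[] :
      colspan (b *m stdmx F s m p l) <> colspan (stdmx F s m p l).
    by rewrite -mxact_colspan; exact: neq.
  set M := h *m b *m stdmx F s m p l => rd ru.
  have /colspan_subP[Q eQ] : (colspan M <= colspan
      (h *m b *m w' *m (pid_mx r : 'M_(s + m, r))))%VS by rewrite eg.
  apply: (@semistable_of_ranks _ s m r p) => //.
  + by rewrite /SL /= !det_mulmx SLh SLb SLw' !mulr1.
  + by lia.
  + suff : (l <= \rank (dsubmx (h *m b *m w' *m (pid_mx r : 'M_(s + m, r)))))%N by lia.
    rewrite (leq_trans rd) // eQ -mul_dsub_mx.
    exact: mxrankM_maxl.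
  + by rewrite (leq_trans ru) // eQ -mul_usub_mx; exact: mxrankM_maxl.
  + exact: ltnW.
Qed.

End SemistableLocus.

Theorem proposition3p8 (R : realType) (n r s p : nat)
    (hn : 2 <= n) (hr : 1 <= r <= n - 1) (hs : 1 <= s <= n - 1)
    (hp : p = (r * s) %/ n)
    (hcase : p = 0 \/ (n <= r + s /\ p = r + s - n)) :
  semistable R[i] r n s =
    translates (levi_ss R[i] n s)
      (schubert_cell R[i] r (w_elt n p s r)
        `\` [set torus_point R[i] r (w_elt n p s r)]).
Proof.
have [m em] : exists m, n = s + m by exists (n - s); lia.
have pn : p * n <= r * s by rewrite hp leq_trunc_div.
have np : r * s < p.+1 * n by rewrite hp ltn_ceil //; lia.
subst n; apply: semistable_eq.
- lia.
- lia.
- nia.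
- nia.
- by case: hcase => [p0|[rs pE]]; [subst p; nia | lia].
(* When [p = r + s - n], strictness comes from [r s - n p = (n - r) (n - s) > 0]. *)
- by case: hcase => [p0|[rs pE]]; [subst p; nia | nia].
- by rewrite [ltnRHS]mulnC.
- by case: hcase => [p0|[rs pE]]; [left | right; lia].
Qed.
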